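(* There exists a universal constant $c_0>0$ such that the following holds. Let $n\ge 2$, let $0<\tau_1\le\dots\le\tau_n$ be the computation times of the workers in the fixed computation model, and consider any randomized method. Fix any $\varepsilon,L_{\max},R,\mu,\sigma^2>0$ such that $\mu<L_{\max}/(2n)$, $\varepsilon<0.01$ and $R>10$. For any time budget $$t\le c_0\left(\frac1n\sum_{i=1}^n\tau_i\right)\frac{\sigma^2}{\varepsilon n\mu^2}$$ there exist a dimension $d$, functions $f_1,\dots,f_n:\mathbb{R}^d\to\mathbb{R}$ with average $f=\frac1n\sum_{i=1}^n f_i$, stochastic gradients $\nabla f_i(\cdot;\cdot)$, and a starting point $x^0$ at distance at most $R$ from the closest minimizer of $f$, such that: (1) every $f_i$ is differentiable, $L_{\max}$-smooth and convex, and $f$ attains its minimum; (2) (weak interpolation) every minimizer of $f$ is a minimizer of each $f_i$, $i\in[n]$; (3) $f$ is $L_{\max}$-smooth and satisfies the Polyak-Łojasiewicz condition with parameter $\mu$; (4) the stochastic gradients are unbiased and $\sigma^2$-variance-bounded; (5) the method started at $x^0$ cannot find an $\varepsilon$-solution in terms of distances to the solution set within $t$ seconds, i.e., every (random) point $\bar x$ it produces within $t$ seconds satisfies $\mathbb{E}\left[\|\bar x-\bar x_*\|^2\right]>\varepsilon$, where $\bar x_*$ is the minimizer of $f$ closest to $\bar x$.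
   Context: $[n]=\{1,\dots,n\}$; $\|\cdot\|$ is the Euclidean norm. A function $g$ is $L$-smooth if $\|\nabla g(x)-\nabla g(y)\|\le L\|x-y\|$ for all $x,y$. Distributed setting: there are $n$ workers operating in parallel and asynchronously; worker $i$ has access only to stochastic gradients $\nabla f_i(x;\xi_i)$, $\xi_i\sim\mathcal{D}_i$, of $f_i$, each returned stochastic gradient using a fresh independent sample. Fixed computation model: worker $i$ computes one stochastic gradient at a time and each computation takes $\tau_i$ seconds, so by time $t$ worker $i$ has returned at most $\lfloor t/\tau_i\rfloor$ stochastic gradients. Randomized method: any procedure that, given a starting point, using its own internal randomness (independent of the gradient noise) and the stochastic gradients returned so far, adaptively decides at which points the workers compute stochastic gradients, and which outputs (random) points depending only on this information. A point is produced within $t$ seconds if it depends only on the internal randomness and on stochastic gradients returned by time $t$. Unbiased, $\sigma^2$-variance-bounded: $\mathbb{E}_{\xi_i}[\nabla f_i(x;\xi_i)]=\nabla f_i(x)$ and $\mathbb{E}_{\xi_i}[\|\nabla f_i(x;\xi_i)-\nabla f_i(x)\|^2]\le\sigma^2$ for all $x\in\mathbb{R}^d$, $i\in[n]$. Polyak-Łojasiewicz condition with parameter $\mu>0$: $\|\nabla f(x)\|^2\ge 2\mu(f(x)-f^* )$ for all $x\in\mathbb{R}^d$, where $f^*$ is the finite optimal value of $f$.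
   Formalization: The points a method produces within t seconds are taken to be a finite list whose length may depend on the method and t but not on d or x^0; otherwise a method listing a dense set or fine net of constant points would refute (5). *)

(* Defs.v *)
From HB Require Import structures.
From mathcomp Require Import all_boot all_order all_algebra.
From mathcomp Require Import all_classical all_reals all_analysis.
From mathcomp Require Import measurable_realfun.

Set Implicit Arguments.
Unset Strict Implicit.
Unset Printing Implicit Defensive.

Import Order.TTheory GRing.Theory Num.Theory.
Import numFieldNormedType.Exports.

Local Open Scope classical_set_scope.
Local Open Scope ring_scope.

(** ** Functions on R^d *)

(* The library norm [`|x|] on ['rV[R]_d] is the sup norm. *)
Definition enorm (R : realType) (d : nat) (x : 'rV[R]_d) : R :=
  Num.sqrt (\sum_(k < d) x 0 k ^+ 2).

(* Only meaningful at points where [f] is differentiable. *)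
Definition grad (R : realType) (d : nat) (f : 'rV[R]_d -> R) (x : 'rV[R]_d) :
  'rV[R]_d := \row_(k < d) 'D_(delta_mx 0 k) f x.

Definition L_smooth (R : realType) (d : nat) (L : R) (f : 'rV[R]_d -> R) :=
  (forall x, differentiable f x) /\
  (forall x y, enorm (grad f x - grad f y) <= L * enorm (x - y)).

Definition convex_on_space (R : realType) (d : nat) (f : 'rV[R]_d -> R) :=
  @convex_function R 'rV[R]_d setT f.

Definition minimizer (R : realType) (d : nat) (f : 'rV[R]_d -> R)
    (x : 'rV[R]_d) := forall y, f x <= f y.

Definition closest_minimizer (R : realType) (d : nat) (f : 'rV[R]_d -> R)
    (x : 'rV[R]_d) : set 'rV[R]_d :=
  [set y | minimizer f y /\
     forall z, minimizer f z -> enorm (x - y) <= enorm (x - z)].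

(* [get] returns an arbitrary point if there is no closest minimizer; if [f] is
   convex, continuous and attains its minimum, it exists and is unique. *)
Definition nearest_min (R : realType) (d : nat) (f : 'rV[R]_d -> R)
    (x : 'rV[R]_d) : 'rV[R]_d := get (closest_minimizer f x).

Definition polyak_lojasiewicz (R : realType) (d : nat) (mu : R)
    (f : 'rV[R]_d -> R) :=
  has_inf (range f) /\
  forall x, 2 * mu * (f x - inf (range f)) <= enorm (grad f x) ^+ 2.

Definition average (R : realType) (n d : nat) (fs : 'I_n -> 'rV[R]_d -> R)
    (x : 'rV[R]_d) : R := n%:R^-1 * \sum_(i < n) fs i x.

(** ** Measurable structures on R^d and on arrays of vectors *)

Definition matrix_generator (R : realType) (m n : nat) :
    set (set 'M[R]_(m, n)) :=
  [set C | exists i j (B : set R),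
     measurable B /\ C = (fun A : 'M[R]_(m, n) => A i j) @^-1` B].

HB.instance Definition _ (R : realType) (m n : nat) :=
  @isMeasurable.Build (sigma_display (@matrix_generator R m n)) 'M[R]_(m, n)
    <<s @matrix_generator R m n >> (@sigma_algebra0 _ setT _)
    (@sigma_algebraC _ _) (@sigma_algebra_bigcup _ setT _).

(* Entry [i j] of an array is the vector returned by the [j]-th completed
   computation of worker [i]; [j] counts from 0. *)
Definition array (R : realType) (n d : nat) := 'I_n -> nat -> 'rV[R]_d.

HB.instance Definition _ (R : realType) (n d : nat) :=
  Pointed.on (array R n d).

Definition array_generator (R : realType) (n d : nat) :
    set (set (array R n d)) :=
  [set C | exists i j (B : set 'rV[R]_d),
     measurable B /\ C = (fun G : array R n d => G i j) @^-1` B].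

HB.instance Definition _ (R : realType) (n d : nat) :=
  @isMeasurable.Build (sigma_display (@array_generator R n d)) (array R n d)
    <<s @array_generator R n d >> (@sigma_algebra0 _ setT _)
    (@sigma_algebraC _ _) (@sigma_algebra_bigcup _ setT _).

(** ** Stochastic gradients *)

Section stochastic_gradients.
Context (R : realType) (d : nat) (disp : measure_display)
  (Xi : measurableType disp) (D : probability Xi R).
Implicit Types (g : 'rV[R]_d -> Xi -> 'rV[R]_d) (f : 'rV[R]_d -> R).

Definition measurable_oracle g :=
  measurable_fun [set: 'rV[R]_d * Xi] (fun p => g p.1 p.2).

Definition unbiased g f :=
  forall x k, ('E_D[fun xi => g x xi 0%R k] = (grad f x 0%R k)%:E)%E.

Definition variance_bounded (sigma2 : R) g f :=
  forall x, ('E_D[fun xi => (enorm (g x xi - grad f x) ^+ 2)%R] <= sigma2%:E)%E.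

End stochastic_gradients.

(** ** Randomized methods in the fixed computation model *)

(* [S i j] is the start time of the [j]-th computation of worker [i], and [+oo]
   if it is never started. The two arrays agree on all that is returned by time
   [t] when the start times are [S]. *)
Definition same_info (R : realType) (n d : nat) (tau : 'I_n -> R)
    (S : 'I_n -> nat -> \bar R) (t : R) (G G' : array R n d) :=
  forall i j, (S i j + (tau i)%:E <= t%:E)%E -> G i j = G' i j.

(* All components of a method are functionals of the starting point [x0], the
   internal randomness [u] and the array [G] of returned gradients; the
   [_causal] fields say that an action taken at time [t] depends only on [u]
   and on the entries of [G] that are returned by time [t].

   [rm_out x0 t k u G], for [k < rm_nout t], are the points that are produced
   within [t] seconds. Their number is finite and does not depend on [d]:
   otherwise a method could list, without any information, a fine enough net of
   a ball around [x0] that contains a minimizer, so that one of the points is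
   always close to it. *)
Record randomized_method (R : realType) (n : nat) (tau : 'I_n -> R) := {
  rm_disp : measure_display ;
  rm_space : measurableType rm_disp ;
  rm_law : probability rm_space R ;

  rm_start : forall d : nat,
    'rV[R]_d -> 'I_n -> nat -> rm_space -> array R n d -> \bar R ;
  rm_query : forall d : nat,
    'rV[R]_d -> 'I_n -> nat -> rm_space -> array R n d -> 'rV[R]_d ;
  rm_nout : R -> nat ;
  rm_out : forall d : nat,
    'rV[R]_d -> R -> nat -> rm_space -> array R n d -> 'rV[R]_d ;

  rm_start_ge0 : forall d (x0 : 'rV[R]_d) i j u G,
    (0 <= rm_start x0 i j u G)%E ;
  (* one computation at a time, each of which takes [tau i] seconds *)
  rm_start_next : forall d (x0 : 'rV[R]_d) i j u G,
    (rm_start x0 i j u G + (tau i)%:E <= rm_start x0 i j.+1 u G)%E ;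

  rm_start_causal : forall d (x0 : 'rV[R]_d) (t : R) u (G G' : array R n d),
    same_info tau (fun i j => rm_start x0 i j u G) t G G' ->
    forall i j, (rm_start x0 i j u G <= t%:E)%E ->
      rm_start x0 i j u G' = rm_start x0 i j u G /\
      rm_query x0 i j u G' = rm_query x0 i j u G ;
  rm_out_causal : forall d (x0 : 'rV[R]_d) (t : R) u (G G' : array R n d),
    same_info tau (fun i j => rm_start x0 i j u G) t G G' ->
    forall k, rm_out x0 t k u G' = rm_out x0 t k u G ;

  rm_start_measurable : forall d (x0 : 'rV[R]_d) i j,
    measurable_fun [set: rm_space * array R n d]
      (fun p => rm_start x0 i j p.1 p.2) ;
  rm_query_measurable : forall d (x0 : 'rV[R]_d) i j,
    measurable_fun [set: rm_space * array R n d]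
      (fun p => rm_query x0 i j p.1 p.2) ;
  rm_out_measurable : forall d (x0 : 'rV[R]_d) t k,
    measurable_fun [set: rm_space * array R n d]
      (fun p => rm_out x0 t k p.1 p.2)
}.

(* A run, on a probability space [(Omega, P)], of the method [A] started at [x0]
   with oracles [g]: [U] is the internal randomness, [xi i j] the sample used in
   the [j]-th computation of worker [i], [G] the array of returned gradients. *)
Record is_run (R : realType) (n : nat) (tau : 'I_n -> R)
    (A : randomized_method tau) (d : nat) (x0 : 'rV[R]_d)
    (dXi : measure_display) (Xi : measurableType dXi)
    (D : 'I_n -> probability Xi R) (g : 'I_n -> 'rV[R]_d -> Xi -> 'rV[R]_d)
    (dO : measure_display) (Omega : measurableType dO)
    (P : probability Omega R) (U : Omega -> rm_space A)
    (xi : 'I_n -> nat -> Omega -> Xi) (G : Omega -> array R n d) : Prop := {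
  run_U_measurable : measurable_fun [set: Omega] U ;
  run_xi_measurable : forall i j, measurable_fun [set: Omega] (xi i j) ;
  run_G_measurable : measurable_fun [set: Omega] G ;
  (* [U] and all the [xi i j] are independent with laws [rm_law A] and [D i] *)
  run_law : forall (N : nat) (B : set (rm_space A)) (C : 'I_n -> nat -> set Xi),
    measurable B -> (forall i j, measurable (C i j)) ->
    P [set w | B (U w) /\ forall i j, (j < N)%N -> C i j (xi i j w)] =
    (rm_law A B * \prod_(i < n) \prod_(j < N) D i (C i j))%E ;
  run_step : forall w i j, (rm_start x0 i j (U w) (G w) < +oo)%E ->
    G w i j = g i (rm_query x0 i j (U w) (G w)) (xi i j w)
}.

(* Main.v *)
(** Each [f_i] is the quadratic [n mu / 2 * |x_(i) - z_(i)|^2] in its own block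
    [x_(i)] of [m] coordinates, so that [f] is [mu / 2 * |x - z|^2]; the block
    [z_(i)] is [delta_i] times a hidden basis vector. The oracle of worker [i]
    replaces [z_(i)] by [z_(i) / p_i] with probability [p_i] and by [0]
    otherwise, which is unbiased. With [delta_i^2] proportional to [eps * tau_i]
    and [p_i] as small as the variance bound allows, a worker is completely
    erased up to time [t] with probability at least [3/4], whatever its speed.
    On that event the outputs do not depend on the hidden vector of block [i];
    as each of the [N] outputs is [delta_i / sqrt 2]-close to at most one of the
    [m > 2 N] candidates, a random candidate is missed by all outputs at once
    with probability at least [1/2]. Averaging over the hidden vectors gives one
    choice for which every output has expected squared error at least
    [3/16 * \sum_i delta_i^2 = 3/2 * eps]. *)

Require Import Defs.
From HB Require Import structures.
From mathcomp Require Import all_boot all_order all_algebra.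
From mathcomp Require Import all_classical all_reals all_analysis.
From mathcomp Require Import measurable_realfun.
From mathcomp Require Import ring lra.

Set Implicit Arguments.
Unset Strict Implicit.
Unset Printing Implicit Defensive.

Import Order.TTheory GRing.Theory Num.Theory.
Import numFieldNormedType.Exports.

Local Open Scope classical_set_scope.
Local Open Scope ring_scope.

(** * Euclidean norm and separable quadratics *)

Lemma enorm_ge0 {R : realType} {d : nat} (x : 'rV[R]_d) : 0 <= enorm x.
Proof. exact: sqrtr_ge0. Qed.

Lemma enorm_sqr {R : realType} {d : nat} (x : 'rV[R]_d) :
  enorm x ^+ 2 = \sum_(k < d) x 0 k ^+ 2.
Proof. by rewrite sqr_sqrtr // sumr_ge0 // => k _; rewrite sqr_ge0. Qed.

Lemma enorm_eq0 {R : realType} {d : nat} (x : 'rV[R]_d) : enorm x = 0 -> x = 0.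
Proof.
move=> x0; have /eqP : enorm x ^+ 2 = 0 by rewrite x0 expr0n.
rewrite enorm_sqr psumr_eq0 => [/allP h|k _]; last exact: sqr_ge0.
apply/rowP => k; rewrite mxE.
by have := h k (mem_index_enum _); rewrite sqrf_eq0 => /eqP.
Qed.

(** Weights may vanish, so one family contains both each [f_i], which sees a single block, and the
    average [f]. *)
Definition quad {R : realType} {d : nat} (w z x : 'rV[R]_d) : R :=
  2^-1 * \sum_(k < d) w 0 k * (x 0 k - z 0 k) ^+ 2.

Section quadratic.
Context (R : realType) (d : nat).
Implicit Types w x y z : 'rV[R]_d.

Lemma quad_fctE w z : quad w z =
  2^-1 \*: \sum_(k < d)
    (w 0 k \*: ((fun x : 'rV[R]_d => x 0 k : R) - cst (z 0 k)) ^+ 2).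
Proof.
apply/funext => x; rewrite /quad /= fct_sumE /=.
by congr (_ * _); apply: eq_bigr => k _; rewrite expr2.
Qed.

Lemma differentiable_quad w z x : differentiable (quad w z) x.
Proof.
rewrite quad_fctE; apply/differentiableZ/differentiable_sum => k.
apply/differentiableZ/differentiableX/differentiableB => //.
exact: differentiable_coord.
Qed.

Lemma is_derive_coord x v (k : 'I_d) :
  is_derive x v (fun x : 'rV[R]_d => x 0 k : R) (v 0 k).
Proof.
apply: DeriveDef; first exact/diff_derivable/differentiable_coord.
have @f : {linear 'rV[R]_d -> R}.
  by exists (fun N : 'rV[R]_d => N 0 k); do 2![eexists]; do ?[constructor];
     rewrite ?mxE// => ? *; rewrite ?mxE//; move=> ?; rewrite !mxE.
rewrite deriveE; last exact: differentiable_coord.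
rewrite (_ : (fun _ => _) = f) // diff_lin //.
exact: coord_continuous.
Qed.

Lemma grad_quad w z x :
  grad (quad w z) x = \row_k (w 0 k * (x 0 k - z 0 k)).
Proof.
apply/rowP => j; rewrite !mxE quad_fctE.
have D k : is_derive x (delta_mx 0 j)
    (w 0 k \*: ((fun x : 'rV[R]_d => x 0 k : R) - cst (z 0 k)) ^+ 2)
    (w 0 k *: (((x 0 k - z 0 k) *+ 2) *: (delta_mx 0 j : 'rV[R]_d) 0 k)).
  apply: is_deriveZ; apply: is_derive_eq.
    apply: is_deriveX; apply: is_deriveB; exact: is_derive_coord.
  by rewrite /= subr0 expr1 mulr_natl.
have := @is_deriveZ _ _ _ _ 2^-1 _ _ _ (is_derive_sum D).
move=> /(@derive_val _ _ _ _ _ _ _) ->.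
rewrite (bigD1 j) //= big1 => [|k kj]; last first.
  by rewrite mxE eqxx (negPf kj) !scaler0.
rewrite mxE !eqxx /= addr0 /GRing.scale /=. by field.
Qed.

Lemma quad_lsmooth w z (L : R) : 0 < L -> (forall k, 0 <= w 0 k <= L) ->
  L_smooth L (quad w z).
Proof.
move=> L0 wL; split=> [x|x y]; first exact: differentiable_quad.
rewrite -(@ler_pXn2r _ 2) ?nnegrE ?mulr_ge0 ?enorm_ge0 ?(ltW L0) //.
rewrite exprMn !enorm_sqr mulr_sumr; apply: ler_sum => k _.
rewrite !grad_quad !mxE -mulrBr opprB addrA subrK.
rewrite exprMn ler_wpM2r ?sqr_ge0 //.
by have /andP[? ?] := wL k; rewrite ler_pXn2r ?nnegrE ?(ltW L0).
Qed.

Lemma quad_convex w z : (forall k, 0 <= w 0 k) -> convex_on_space (quad w z).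
Proof.
move=> w0 t x y _ _.
rewrite [leRHS]convRE /quad !(mulrCA _ 2^-1) -mulrDr ler_pM2l ?invr_gt0 //.
rewrite !mulr_sumr -big_split /=; apply: ler_sum => k _.
rewrite !mxE /unstable.onem -subr_ge0.
have t0 : 0 <= t%:num by exact: ge0.
have t1 : 0 <= 1 - t%:num by rewrite subr_ge0; exact: le1.
set tn := t%:num in t0 t1 *.
(* The convexity gap of the square in coordinate [k] is exactly this product
   [w * t * (1 - t) * (x - y)^2]. *)
have := mulr_ge0 (mulr_ge0 (w0 k) (mulr_ge0 t0 t1)) (sqr_ge0 (x 0 k - y 0 k)).
by congr (0 <= _); ring.
Qed.

Lemma quad_ge0 w z x : (forall k, 0 <= w 0 k) -> 0 <= quad w z x.
Proof.
move=> w0; rewrite /quad mulr_ge0 ?invr_ge0 // sumr_ge0 // => k _.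
by rewrite mulr_ge0 // sqr_ge0.
Qed.

Lemma quad_center w z : quad w z z = 0.
Proof.
by rewrite /quad big1 ?mulr0 // => k _; rewrite subrr expr0n mulr0.
Qed.

Lemma quad_center_minimizer w z : (forall k, 0 <= w 0 k) ->
  minimizer (quad w z) z.
Proof. by move=> w0 y; rewrite quad_center quad_ge0. Qed.

(** Since the center is shared, averaging only acts on the weights and stays within the family. *)
Lemma average_quad (n : nat) (w : 'I_n -> 'rV[R]_d) z :
  average (fun i => quad (w i) z) = quad (n%:R^-1 *: \sum_(i < n) w i) z.
Proof.
apply/funext => x; rewrite /average /quad -mulr_sumr mulrCA exchange_big /=.
congr (_ * _); rewrite mulr_sumr; apply: eq_bigr => k _.
by rewrite -mulr_suml mulrA mxE summxE.
Qed.

End quadratic.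

Section scaled_square_norm.
Context (R : realType) (d : nat) (mu : R) (z : 'rV[R]_d) (mu_gt0 : 0 < mu).

Let w0 (k : 'I_d) : 0 <= (const_mx mu : 'rV[R]_d) 0 k.
Proof. by rewrite mxE ltW. Qed.

Lemma quad_constE x : quad (const_mx mu) z x = mu / 2 * enorm (x - z) ^+ 2.
Proof.
rewrite /quad enorm_sqr mulrAC mulrC mulr_sumr; congr (_ * _).
by apply: eq_bigr => k _; rewrite !mxE.
Qed.

Lemma quad_const_minimizer x : minimizer (quad (const_mx mu) z) x <-> x = z.
Proof.
split=> [/(_ z)|->]; last exact: quad_center_minimizer.
rewrite quad_center quad_constE pmulr_rle0 ?divr_gt0 // => h.
apply/eqP; rewrite -subr_eq0; apply/eqP/enorm_eq0/eqP.
by rewrite -sqrf_eq0 eq_le h sqr_ge0.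
Qed.

Lemma nearest_min_quad_const x : nearest_min (quad (const_mx mu) z) x = z.
Proof.
apply/quad_const_minimizer.
suff /getPex [] : exists y, closest_minimizer (quad (const_mx mu) z) x y by [].
exists z; split=> [|y /quad_const_minimizer -> //].
exact/quad_const_minimizer.
Qed.

(** Equality holds for this quadratic: the infimum is [0], and both sides are [mu ^+ 2] times the
    squared distance to [z]. *)
Lemma quad_const_pl : polyak_lojasiewicz mu (quad (const_mx mu) z).
Proof.
have inf0 : lbound (range (quad (const_mx mu) z)) 0.
  by move=> _ [x _ <-]; exact: quad_ge0.
split; first by split; [exists (quad (const_mx mu) z z), z|exists 0].
move=> x; rewrite (_ : inf _ = 0); last first.
  apply/eqP; rewrite eq_le lb_le_inf //; last by exists (quad (const_mx mu) z z), z.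
  rewrite andbT; apply: ge_inf; first by exists 0.
  by exists z => //; rewrite quad_center.
rewrite subr0 quad_constE grad_quad !enorm_sqr.
rewrite [leLHS](_ : _ = mu ^+ 2 * \sum_(k < d) (x - z) 0 k ^+ 2); last by field.
rewrite mulr_sumr le_eqVlt; apply/orP; left; apply/eqP/eq_bigr => k _.
by rewrite !mxE exprMn.
Qed.

End scaled_square_norm.

(** * Block coordinates and hidden vectors *)

Section block_coordinates.
Context (R : realType) (n m : nat).
Local Notation d := #|{: 'I_n * 'I_m}|.
Implicit Types (x : 'rV[R]_d) (i : 'I_n) (c : 'I_m) (delta : 'I_n -> R)
  (s : {ffun 'I_n -> 'I_m}).

(** The map [s] selects one basis vector per block; coordinates are pairs (block, position)
    flattened by [enum_val]. *)
Definition code delta s : 'rV[R]_d :=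
  \row_k (delta (enum_val k).1 * ((enum_val k).2 == s (enum_val k).1)%:R).

Definition block_weight (a : R) i : 'rV[R]_d :=
  \row_k (a * ((enum_val k).1 == i)%:R).

Definition block_err (r : R) i c x : R :=
  \sum_(c' < m) (x 0 (enum_rank (i, c')) - r * (c' == c)%:R) ^+ 2.

Lemma sum_blocks (F : 'I_d -> R) :
  \sum_(k < d) F k = \sum_(i < n) \sum_(c < m) F (enum_rank (i, c)).
Proof.
rewrite pair_big /= (reindex (@enum_rank _)) /=; last first.
  by exists (@enum_val _ _) => ? _; rewrite ?enum_rankK ?enum_valK.
by apply: eq_bigr => -[i c] _.
Qed.

Lemma enorm_sub_code x delta s :
  enorm (x - code delta s) ^+ 2 = \sum_(i < n) block_err (delta i) i (s i) x.
Proof.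
rewrite enorm_sqr sum_blocks; apply: eq_bigr => i _; apply: eq_bigr => c _.
by rewrite !mxE enum_rankK.
Qed.

Lemma sum_sqr_code_block delta s i :
  \sum_(c < m) code delta s 0 (enum_rank (i, c)) ^+ 2 = delta i ^+ 2.
Proof.
rewrite (bigD1 (s i)) //= big1 => [|c csi]; last first.
  by rewrite mxE enum_rankK /= (negPf csi) mulr0 expr0n.
by rewrite mxE enum_rankK eqxx mulr1 addr0.
Qed.

Lemma sum_sqr_weight_code a delta s i :
  \sum_(k < d) (block_weight a i 0 k * code delta s 0 k) ^+ 2 =
  a ^+ 2 * delta i ^+ 2.
Proof.
rewrite sum_blocks (bigD1 i) //= [X in _ + X]big1 ?addr0 => [|k ki].
  rewrite -(sum_sqr_code_block delta s) mulr_sumr; apply: eq_bigr => c _.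
  by rewrite [block_weight _ _ _ _]mxE enum_rankK eqxx mulr1 exprMn.
rewrite big1 // => c _.
by rewrite [block_weight _ _ _ _]mxE enum_rankK (negPf ki) mulr0 mul0r expr0n.
Qed.

Lemma enorm_code delta s :
  enorm (code delta s) ^+ 2 = \sum_(i < n) delta i ^+ 2.
Proof.
rewrite enorm_sqr sum_blocks; apply: eq_bigr => i _.
exact: sum_sqr_code_block.
Qed.

Lemma sum_block_weight a : \sum_(i < n) block_weight a i = const_mx a.
Proof.
apply/rowP => k; rewrite summxE mxE (bigD1 (enum_val k).1) //= big1 => [|i ik].
  by rewrite mxE eqxx mulr1 addr0.
by rewrite mxE eq_sym (negPf ik) mulr0.
Qed.

Lemma block_err_ge0 r i c x : 0 <= block_err r i c x.
Proof. by apply: sumr_ge0 => ? _; rewrite sqr_ge0. Qed.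

(** Only positions [c] and [c'] matter: each contributes [u^2 + (u - r)^2], which is at least
    [r^2 / 2]. Hence both errors cannot be below [r^2 / 2], and a point is close to at most one
    candidate. *)
Lemma block_err_sep r i c c' x : c != c' ->
  r ^+ 2 <= block_err r i c x + block_err r i c' x.
Proof.
move=> cc'.
have lb e : (x 0 (enum_rank (i, c)) - r * (c == e)%:R) ^+ 2 +
    (x 0 (enum_rank (i, c')) - r * (c' == e)%:R) ^+ 2 <= block_err r i e x.
  rewrite /block_err (bigD1 c) //= lerD2l (bigD1 c') 1?eq_sym //= lerDl.
  by apply: sumr_ge0 => ? _; rewrite sqr_ge0.
have := lerD (lb c) (lb c'); apply: le_trans.
rewrite !eqxx [c' == c]eq_sym (negPf cc') !mulr0 !mulr1 !subr0.
have := sqr_ge0 (2 * x 0 (enum_rank (i, c)) - r).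
have := sqr_ge0 (2 * x 0 (enum_rank (i, c')) - r).
set u := x _ _; set v := x _ _; nra.
Qed.

End block_coordinates.

(** * The erasure oracle and measurability *)

Definition erasure_oracle {R : realType} {d : nat} (w z : 'rV[R]_d) (p : R)
    (x : 'rV[R]_d) (xi : bool) : 'rV[R]_d :=
  \row_k (w 0 k * (x 0 k - z 0 k * (xi%:R / p))).

Section matrix_measurability.
Context (R : realType).

Lemma measurable_entry (m n : nat) (i : 'I_m) (j : 'I_n) :
  measurable_fun [set: 'M[R]_(m, n)] (fun A : 'M[R]_(m, n) => A i j).
Proof.
move=> _ B mB; rewrite setTI; apply: sub_sigma_algebra.
by exists i, j, B.
Qed.

Lemma measurable_matrix {dT} {T : measurableType dT} {m n : nat}
    (f : T -> 'M[R]_(m, n)) :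
  (forall i j, measurable_fun [set: T] (fun x => f x i j)) ->
  measurable_fun [set: T] f.
Proof.
move=> mf; apply: (@measurability _ _ _ _ _ _ (@matrix_generator R m n)) => //.
move=> _ [_ [i [j [B [mB ->]]]] <-]; rewrite setTI.
by have := mf i j measurableT B mB; rewrite setTI.
Qed.

Lemma measurable_array {dT} {T : measurableType dT} {n d : nat}
    (f : T -> array R n d) :
  (forall i j, measurable_fun [set: T] (fun x => f x i j)) ->
  measurable_fun [set: T] f.
Proof.
move=> mf; apply: (@measurability _ _ _ _ _ _ (@array_generator R n d)) => //.
move=> _ [_ [i [j [B [mB ->]]]] <-]; rewrite setTI.
by have := mf i j measurableT B mB; rewrite setTI.
Qed.

(** This shape covers the oracle as a function of point and sample jointly, and also the answers
    with a frozen bit. *)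
Lemma measurable_rV_affine {dT} {T : measurableType dT} {d : nat}
    (f : T -> 'rV[R]_d) (w : 'rV[R]_d) (b : 'I_d -> T -> R) :
  measurable_fun [set: T] f -> (forall k, measurable_fun [set: T] (b k)) ->
  measurable_fun [set: T] (fun x => \row_k (w 0 k * (f x 0 k - b k x))).
Proof.
move=> mf mb; apply: measurable_matrix => i k.
under eq_fun do rewrite mxE.
apply: measurable_funM => //; apply: measurable_funB => //.
exact: (measurableT_comp (@measurable_entry 1 d 0 k)).
Qed.

End matrix_measurability.

Section erasure_oracle_theory.
Context (R : realType) (d : nat) (w z : 'rV[R]_d) (p : R) (p01 : 0 < p < 1).

Let p_gt0 : 0 < p. Proof. by case/andP: p01. Qed.
Let p_neq0 : p != 0. Proof. by rewrite gt_eqF. Qed.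
Let p_01 : 0 <= p <= 1. Proof. by case/andP: p01 => *; rewrite !ltW. Qed.

Lemma erasure_oracle_measurable : measurable_oracle (erasure_oracle w z p).
Proof.
rewrite /measurable_oracle /erasure_oracle.
apply: (@measurable_rV_affine _ _ _ _ fst w
  (fun k (q : 'rV[R]_d * bool) => z 0 k * (q.2%:R / p))) => [|k].
  exact: measurable_fst.
have mb : measurable_fun [set: bool] (fun b : bool => z 0 k * (b%:R / p)) by [].
exact: (measurableT_comp mb measurable_snd).
Qed.

Lemma expectation_bernoulli (f : bool -> R) :
  ('E_(bernoulli_prob p : probability bool R)[f] =
   (p * f true + (1 - p) * f false)%:E)%E.
Proof.
rewrite unlock integralE !integral_bernoulli_prob //.
rewrite /unstable.onem !funeposE !funenegE.
rewrite -!EFin_max -!EFinM -!EFinD; congr (_%:E).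
(* The integral is computed on positive and negative parts separately; this identity reassembles
   them. *)
have h x : x = Num.max x 0 - Num.max (- x) 0 :> R.
  by rewrite maxr_absE maxr_absE !subr0 !addr0 normrN; field.
rewrite [in RHS](h (f true)) [in RHS](h (f false)); ring.
Qed.

Lemma erasure_oracle_unbiased :
  unbiased (bernoulli_prob p) (erasure_oracle w z p) (quad w z).
Proof.
move=> x k; rewrite expectation_bernoulli grad_quad !mxE.
by congr (_%:E) => /=; field.
Qed.

(** The noise [w * z * (1 - xi / p)] does not involve [x], and [xi / p] has variance [1 / p - 1]. *)
Lemma erasure_oracle_variance x :
  ('E_(bernoulli_prob p)[fun xi =>
    (enorm (erasure_oracle w z p x xi - grad (quad w z) x) ^+ 2)%R] =
  ((\sum_(k < d) (w 0%R k * z 0%R k) ^+ 2) * (p^-1 - 1))%:E)%E.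
Proof.
rewrite expectation_bernoulli.
have E b : enorm (erasure_oracle w z p x b - grad (quad w z) x) ^+ 2 =
    (\sum_(k < d) (w 0 k * z 0 k) ^+ 2) * (1 - b%:R / p) ^+ 2.
  rewrite enorm_sqr mulr_suml; apply: eq_bigr => k _.
  by rewrite grad_quad !mxE -exprMn; congr (_ ^+ 2); ring.
by rewrite !E; congr (_%:E) => /=; field.
Qed.

End erasure_oracle_theory.

(** * Replaying a method from its internal randomness and the answers *)

Section execution.
Context (R : realType) (n : nat) (tau : 'I_n -> R) (A : randomized_method tau)
  (d : nat) (x0 : 'rV[R]_d).
Implicit Types (h : 'I_n -> nat -> 'rV[R]_d -> 'rV[R]_d) (G : array R n d).

Lemma rm_start_ge (tau_ge0 : forall i, 0 <= tau i) i j (u : rm_space A) G :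
  ((j%:R * tau i)%:E <= rm_start x0 i j u G)%E.
Proof.
elim: j => [|j IH]; first by rewrite mul0r rm_start_ge0.
apply: le_trans (rm_start_next x0 i j u G).
by rewrite -natr1 mulrDl mul1r EFinD leeD2r.
Qed.

(* Each round can only correct entries whose computation starts after the
   entries corrected by the previous rounds have been returned; since every
   computation lasts at least [tmin], [k] rounds settle all that is returned by
   time [k * tmin]. *)
Definition exec_array h (k : nat) (u : rm_space A) : array R n d :=
  iter k (fun G i j => h i j (rm_query x0 i j u G)) (fun _ _ => 0).

Lemma same_info_exec_array h (u : rm_space A) G (tmin t : R) :
  0 < tmin -> (forall i, tmin <= tau i) ->
  (forall i j, (rm_start x0 i j u G + (tau i)%:E <= t%:E)%E ->
     G i j = h i j (rm_query x0 i j u G)) ->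
  forall (k : nat) (t' : R), t' <= t -> t' <= k%:R * tmin ->
  same_info tau (fun i j => rm_start x0 i j u G) t' G (exec_array h k u).
Proof.
(* With [k = 0] the time [t'] is at most [0], so nothing has been returned yet. *)
move=> tmin0 taumin Gh; elim=> [|k IH] t' t't t'k i j Sij.
  have : (t'%:E < rm_start x0 i j u G + (tau i)%:E)%E.
    apply: (@lt_le_trans _ _ (tau i)%:E); last by rewrite leeDr ?rm_start_ge0.
    by rewrite lte_fin (le_lt_trans t'k) // mul0r (lt_le_trans tmin0).
  by rewrite ltNge Sij.
rewrite Gh /=; last by apply: le_trans Sij _; rewrite lee_fin.
(* A computation returned by [t'] starts by [t' - tmin], where the previous round already agrees
   with [G]; causality then fixes its query. *)
have Sk : (rm_start x0 i j u G <= (t' - tmin)%:E)%E.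
  have : (rm_start x0 i j u G + (tau i)%:E <= t'%:E)%E by [].
  rewrite EFinB leeBrDr //; apply: le_trans; apply: leeD2l.
  by rewrite lee_fin.
have t1 : t' - tmin <= t by apply: le_trans t't; rewrite gerBl ltW.
have t2 : t' - tmin <= k%:R * tmin.
  by rewrite lerBlDr; move: t'k; rewrite -natr1 mulrDl mul1r.
by have [_ ->] := rm_start_causal (IH _ t1 t2) Sk.
Qed.

(** The array [G] has to obey the recursion only where it is returned by time [t]; causality makes
    the outputs blind to the rest. *)
Lemma rm_out_exec_array h (u : rm_space A) G (tmin t : R) (k l : nat) :
  0 < tmin -> (forall i, tmin <= tau i) -> t <= k%:R * tmin ->
  (forall i j, (rm_start x0 i j u G + (tau i)%:E <= t%:E)%E ->
     G i j = h i j (rm_query x0 i j u G)) ->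
  rm_out x0 t l u (exec_array h k u) = rm_out x0 t l u G.
Proof.
move=> tmin0 taumin tk Gh; apply: rm_out_causal.
exact: (same_info_exec_array tmin0 taumin Gh).
Qed.

Lemma measurable_exec_array h k :
  (forall i j, measurable_fun [set: 'rV[R]_d] (h i j)) ->
  measurable_fun [set: rm_space A] (exec_array h k).
Proof.
move=> mh; elim: k => [|k IH]; first exact: measurable_cst.
apply: measurable_array => i j /=.
apply: (measurableT_comp (mh i j)).
have mg : measurable_fun [set: rm_space A] (fun u => (u, exec_array h k u)).
  exact: measurable_fun_pair.
exact: (measurableT_comp (rm_query_measurable x0 i j) mg).
Qed.

Lemma measurable_rm_out_exec_array h k (t : R) l :
  (forall i j, measurable_fun [set: 'rV[R]_d] (h i j)) ->
  measurable_fun [set: rm_space A] (fun u => rm_out x0 t l u (exec_array h k u)).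
Proof.
move=> mh.
have mg : measurable_fun [set: rm_space A] (fun u => (u, exec_array h k u)).
  by apply: measurable_fun_pair => //; exact: measurable_exec_array.
exact: (measurableT_comp (rm_out_measurable x0 t l) mg).
Qed.

End execution.

(** * Missing the hidden vector of an erased worker *)

Section hard_instances.
Context (R : realType) (n m : nat) (tau : 'I_n -> R) (A : randomized_method tau).
Local Notation d := #|{: 'I_n * 'I_m}|.
Context (x0 : 'rV[R]_d) (t : R) (M : nat) (a : R) (delta p : 'I_n -> R).
Implicit Types (s : {ffun 'I_n -> 'I_m}) (b : {ffun 'I_n * 'I_M -> bool})
  (i : 'I_n) (c : 'I_m).

Definition update s i c : {ffun 'I_n -> 'I_m} :=
  [ffun k => if k == i then c else s k].

(** The [j]-th computation cannot start before [j * tau i], so this is necessary for being returned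
    by time [t], whatever the method does. Erasure thereby becomes an event about the samples
    alone. *)
Definition completed i (j : nat) := j.+1%:R * tau i <= t.

Definition erased i b :=
  [forall j : 'I_M, completed i j ==> ~~ b (i, j)].

(** The default [false] concerns indices from [M] on; [M] will be chosen so that no such computation
    is completed. *)
Definition bit b i (j : nat) : bool :=
  if insub j is Some j' then b (i, j') else false.

(* Answers that are not returned by time [t] are set to [0]; otherwise those of
   an erased worker would still depend on its hidden vector. *)
Definition answer s b i (j : nat) (x : 'rV[R]_d) : 'rV[R]_d :=
  if completed i j
  then erasure_oracle (block_weight m a i) (code delta s) (p i) x (bit b i j)
  else 0.

Definition exec_out s b (l : nat) (u : rm_space A) : 'rV[R]_d :=
  rm_out x0 t l u (exec_array x0 (answer s b) M u).

(** All outputs must miss simultaneously, so that the event, and later the choice of [s], does not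
    depend on the output considered. *)
Definition miss s b i : set (rm_space A) :=
  [set u | forall l, (l < rm_nout A t)%N ->
     delta i ^+ 2 / 2 <= block_err (delta i) i (s i) (exec_out s b l u)].

(** The candidate [c] is separate from the instance [s] driving the execution, so that all
    candidates can be compared on one execution. *)
Definition hit c s b i l : set (rm_space A) :=
  [set u | block_err (delta i) i c (exec_out s b l u) < delta i ^+ 2 / 2].

(** The hidden vector of block [i] enters only the answers of worker [i], multiplied by the sample,
    and every relevant sample is [false]. *)
Lemma erased_answer s b i c : erased i b -> answer (update s i c) b = answer s b.
Proof.
move=> /forallP er; apply/funext => i'; apply/funext => j; apply/funext => x.
rewrite /answer; case: ifPn => // cij; apply/rowP => k; rewrite !mxE.
have [ki'|] := eqVneq (enum_val k).1 i'; last by rewrite mulr0 !mul0r.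
have [ii'|ii'] := eqVneq i' i; last by rewrite ffunE ki' (negPf ii').
suff -> : bit b i' j = false by rewrite !mul0r !mulr0.
rewrite /bit; case: insubP => // j' _ jj'; rewrite ii'.
by have /implyP/(_ _)/negPf := er j'; apply; rewrite jj' -ii'.
Qed.

Lemma measurable_exec_out s b l : measurable_fun [set: rm_space A] (exec_out s b l).
Proof.
apply: measurable_rm_out_exec_array => i j.
rewrite /answer; case: (completed i j); last exact: measurable_cst.
by apply: (@measurable_rV_affine _ _ _ _ id) => // k; exact: measurable_cst.
Qed.

Lemma measurable_block_err i c {dT} {T : measurableType dT} (f : T -> 'rV[R]_d) :
  measurable_fun [set: T] f ->
  measurable_fun [set: T] (fun x => block_err (delta i) i c (f x)).
Proof.
move=> mf; apply: measurable_sum => c'; apply: measurable_funX.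
apply: measurable_funB => //.
exact: (measurableT_comp (@measurable_entry R 1 d 0 _)).
Qed.

Lemma measurable_hit c s b i l : measurable (hit c s b i l).
Proof.
have mf := measurable_block_err i c (measurable_exec_out s b l).
have := measurable_fun_ltr mf (measurable_cst (delta i ^+ 2 / 2)).
move=> /(_ measurableT [set true] I); rewrite setTI.
by congr measurable; apply/seteqP; split=> u.
Qed.

Lemma missE s b i :
  miss s b i = ~` \big[setU/set0]_(l < rm_nout A t) hit (s i) s b i l.
Proof.
rewrite -bigcup_mkord; apply/seteqP; split=> u /=.
  by move=> ms [l /= lN]; rewrite /hit /= ltNge ms.
move=> nn l lN; rewrite leNgt; apply/negP => ll.
by apply: nn; exists l.
Qed.

Lemma measurable_miss s b i : measurable (miss s b i).
Proof.
rewrite missE; apply: measurableC; apply: bigsetU_measurable => l _.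
exact: measurable_hit.
Qed.

Definition rm_prob (B : set (rm_space A)) : R := fine (rm_law A B).

Lemma rm_probE B : measurable B -> rm_law A B = (rm_prob B)%:E.
Proof. by move=> mB; rewrite fineK // fin_num_measure. Qed.

(** By [block_err_sep], hits of distinct candidates by the same output are disjoint events. *)
Lemma sum_hit_le1 s b i l : \sum_(c < m) rm_prob (hit c s b i l) <= 1.
Proof.
rewrite -lee_fin -sumEFin.
under eq_bigr do rewrite -(rm_probE (measurable_hit _ _ _ _ _)).
rewrite -(@measure_bigsetU_ord _ _ _ _ _ xpredT).
- by apply: probability_le1; apply: bigsetU_measurable => c _; exact: measurable_hit.
- by move=> c; exact: measurable_hit.
apply/trivIsetP => c c' _ _ cc'; apply/seteqP; split=> // u [].
rewrite /hit /= => h h'.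
have := block_err_sep (delta i) i (exec_out s b l u) cc'.
by rewrite leNgt [X in _ < X]splitr ltrD.
Qed.

Lemma rm_prob_miss_ge s b i :
  1 - \sum_(l < rm_nout A t) rm_prob (hit (s i) s b i l) <= rm_prob (miss s b i).
Proof.
have mU : measurable (\big[setU/set0]_(l < rm_nout A t) hit (s i) s b i l).
  by apply: bigsetU_measurable => l _; exact: measurable_hit.
rewrite -lee_fin -(rm_probE (measurable_miss _ _ _)) missE probability_setC //.
rewrite EFinB leeB // -sumEFin.
under [leRHS]eq_bigr do rewrite -(rm_probE (measurable_hit _ _ _ _ _)).
by apply: content_subadditive => // l _; exact: measurable_hit.
Qed.

(** Under erasure the [m] instances share the same execution. After a union bound over the outputs,
    each output removes at most [1] from the total over the candidates. *)
Lemma sum_miss_ge s b i : erased i b ->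
  m%:R - (rm_nout A t)%:R <= \sum_(c < m) rm_prob (miss (update s i c) b i).
Proof.
move=> er.
apply: le_trans (ler_sum _ (fun c _ => rm_prob_miss_ge (update s i c) b i)).
rewrite sumrB sumr_const card_ord lerD2l lerN2 exchange_big /=.
rewrite -[leRHS](_ : \sum_(l < rm_nout A t) 1 = _); last by rewrite sumr_const card_ord.
apply: ler_sum => l _; apply: le_trans (sum_hit_le1 s b i l).
rewrite le_eqVlt; apply/orP; left; apply/eqP/eq_bigr => c _.
by rewrite /hit /exec_out erased_answer // ffunE eqxx.
Qed.

End hard_instances.

(** * Product and averaging inequalities *)

Lemma prod_onem_ge {R : realDomainType} {I : Type} (r : seq I) (e : I -> R) :
  (forall x, 0 <= e x <= 1) -> 1 - \sum_(x <- r) e x <= \prod_(x <- r) (1 - e x).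
Proof.
move=> e01.
(* The induction also carries that the product lies in [[0, 1]], which makes the cross term
   harmless. *)
suff : 0 <= \prod_(x <- r) (1 - e x) /\
    1 - \sum_(x <- r) e x <= \prod_(x <- r) (1 - e x) <= 1.
  by case=> _ /andP[].
elim: r => [|x r [IH0 /andP[IH1 IH2]]]; first by rewrite !big_nil subr0 lexx ler01.
rewrite !big_cons; have /andP[e0 e1] := e01 x.
set S := \sum_(_ <- r) _ in IH1 *; set Q := \prod_(_ <- r) _ in IH0 IH1 IH2 *.
split; first by rewrite mulr_ge0 // subr_ge0.
by apply/andP; split; nra.
Qed.

Lemma exists_ge_average {R : realDomainType} {I : finType} (V : I -> R) (v : R)
    (i0 : I) :
  #|I|%:R * v <= \sum_i V i -> exists i, v <= V i.
Proof.
move=> h; apply/existsP; apply: contraLR h => /existsPn nV.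
rewrite -ltNge mulr_natl -sumr_const.
apply: ltr_sum => [|i _]; last by rewrite ltNge nV.
by apply/hasP; exists i0; rewrite ?mem_index_enum.
Qed.

(** Resampling one letter of a uniformly random [s] leaves it uniform: exchanging the letter [s i]
    with the spare letter [c] is an involution. *)
Lemma sum_update {R : realDomainType} {n m : nat}
    (F : {ffun 'I_n -> 'I_m} -> R) (i : 'I_n) :
  \sum_s \sum_(c < m) F (update s i c) = m%:R * \sum_s F s.
Proof.
pose swap (q : {ffun 'I_n -> 'I_m} * 'I_m) := (update q.1 i q.2, q.1 i).
rewrite pair_big /= (reindex swap) /=.
  rewrite -(pair_big xpredT xpredT
    (fun s c => F (update (update s i c) i (s i)))) /= mulr_sumr.
  apply: eq_bigr => s _.
  rewrite -[in RHS](_ : \sum_(c < m) 1 = m%:R :> R); last by rewrite sumr_const card_ord.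
  rewrite mulr_suml; apply: eq_bigr => c _; rewrite mul1r; congr F.
  by apply/ffunP => k; rewrite !ffunE; case: eqVneq => // ->.
have invol : involutive swap.
  move=> [s c]; rewrite /swap /=; congr pair; last by rewrite ffunE eqxx.
  by apply/ffunP => k; rewrite !ffunE; case: eqVneq => // ->.
by exists swap => q _; exact: invol.
Qed.

(** * From the average over instances to actual runs *)

Section runs.
Context (R : realType) (n m : nat) (tau : 'I_n -> R) (A : randomized_method tau).
Local Notation d := #|{: 'I_n * 'I_m}|.
Context (x0 : 'rV[R]_d) (t tmin : R) (M : nat) (a : R) (delta p : 'I_n -> R)
  (p01 : forall i, 0 < p i < 1) (tmin_gt0 : 0 < tmin)
  (taumin : forall i, tmin <= tau i) (tM : t <= M%:R * tmin).
Implicit Types (s : {ffun 'I_n -> 'I_m}) (b : {ffun 'I_n * 'I_M -> bool})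
  (i : 'I_n).

(** This is the probability of the sample pattern [b] under independent Bernoulli laws. *)
Definition weight b : R :=
  \prod_(q : 'I_n * 'I_M) (if b q then p q.1 else 1 - p q.1).

(** A lower bound on the expected squared error that is common to all outputs, so one good [s]
    serves them all. *)
Definition score s : R := \sum_(i < n) delta i ^+ 2 / 2 *
  \sum_(b : {ffun 'I_n * 'I_M -> bool} | erased tau t i b)
     weight b * rm_prob (miss (A := A) x0 t a delta p s b i).

Lemma weight_ge0 b : 0 <= weight b.
Proof.
apply: prodr_ge0 => -[i j] _ /=; have /andP[p0 p1] := p01 i.
by case: ifP; rewrite ?subr_ge0 ltW.
Qed.

Lemma sum_weight_erased i :
  1 - \sum_(j < M | completed tau t i j) p i <=
  \sum_(b : {ffun 'I_n * 'I_M -> bool} | erased tau t i b) weight b.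
Proof.
pose e (q : 'I_n * 'I_M) := if (q.1 == i) && completed tau t i q.2 then p q.1 else 0.
have -> : \sum_(j < M | completed tau t i j) p i = \sum_q e q.
  rewrite -(pair_big xpredT xpredT (fun i j => e (i, j))) /= (bigD1 i) //=.
  rewrite [X in _ + X]big1 ?addr0 => [|k ki]; last first.
    by rewrite big1 // => j _; rewrite /e /= (negPf ki).
  by rewrite big_mkcond; apply: eq_bigr => j _; rewrite /e /= eqxx.
apply: le_trans (prod_onem_ge _ _) _ => [q|].
  rewrite /e; case: ifP; rewrite ?lexx ?ler01 // => _.
  by have /andP[p0 p1] := p01 q.1; rewrite !ltW.
(* [F] gives weight [0] to a forbidden success; expanding the product of sums over the bits then
   leaves exactly the erased patterns. *)
pose F (q : 'I_n * 'I_M) (y : bool) : R :=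
  if (q.1 == i) && completed tau t i q.2 && y then 0
  else if y then p q.1 else 1 - p q.1.
rewrite (eq_bigr (fun q => \sum_y F q y)) => [|q _]; last first.
  by rewrite big_bool /F /e andbT andbF; case: ifP => _ /=; ring.
rewrite bigA_distr_bigA [leRHS]big_mkcond le_eqVlt; apply/orP; left.
apply/eqP/eq_bigr => b _; case: ifPn => [/forallP er|].
  apply: eq_bigr => -[k j] _; rewrite /F; case: eqVneq => //= ->.
  by have := er j; case: (completed _ _ _ _) => //= /negPf ->.
rewrite negb_forall => /existsP[j]; rewrite negb_imply negbK => /andP[cij bij].
by rewrite (bigD1 (i, j)) //= /F /= eqxx cij bij mul0r.
Qed.

(** Probabilistic method over uniform [s]. The factor [3 / 16] is [1 / 2] from the miss radius,
    [3 / 4] from erasure and [1 / 2] from missing the candidate. *)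
Lemma exists_good_score :
  (forall i, \sum_(j < M | completed tau t i j) p i <= 4^-1) ->
  (2 * rm_nout A t < m)%N ->
  exists s, 3 / 16 * \sum_(i < n) delta i ^+ 2 <= score s.
Proof.
move=> psmall mN.
have m_gt0 : (0 < m)%N by exact: leq_ltn_trans mN.
have half i b : erased tau t i b ->
    #|{ffun 'I_n -> 'I_m}|%:R / 2 <=
    \sum_s rm_prob (miss (A := A) x0 t a delta p s b i).
  move=> er; rewrite -(ler_pM2l (_ : 0 < m%:R :> R)) ?ltr0n //.
  rewrite -(sum_update (fun s => rm_prob (miss x0 t a delta p s b i)) i).
  apply: (@le_trans _ _ (\sum_(s : {ffun 'I_n -> 'I_m}) (m%:R - (rm_nout A t)%:R))).
    rewrite sumr_const -[leRHS]mulr_natl mulrCA ler_wpM2l //.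
    have : 2 * (rm_nout A t)%:R <= m%:R :> R by rewrite -natrM ler_nat ltnW.
    by lra.
  by apply: ler_sum => s _; exact: sum_miss_ge.
apply: (@exists_ge_average _ _ _ _ [ffun=> Ordinal m_gt0]).
rewrite exchange_big /= mulrA mulr_sumr; apply: ler_sum => i _.
rewrite -mulr_sumr exchange_big /=.
have d2 : 0 <= delta i ^+ 2 / 2 by rewrite divr_ge0 // sqr_ge0.
rewrite [leLHS](_ : _ = delta i ^+ 2 / 2 *
  (3 / 4 * (#|{ffun 'I_n -> 'I_m}|%:R / 2))); last by field.
apply: ler_wpM2l => //.
apply: (@le_trans _ _ (\sum_(b : {ffun 'I_n * 'I_M -> bool} | erased tau t i b)
    weight b * (#|{ffun 'I_n -> 'I_m}|%:R / 2))).
  rewrite -mulr_suml ler_wpM2r ?divr_ge0 //.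
  apply: le_trans (sum_weight_erased i).
  by have := psmall i; lra.
apply: ler_sum => b er; rewrite -mulr_sumr ler_wpM2l ?weight_ge0 //.
exact: half.
Qed.

Definition missed {dO} {Omega : measurableType dO} (U : Omega -> rm_space A)
    (G : Omega -> array R n d) s i : set Omega :=
  [set w | forall l, (l < rm_nout A t)%N ->
     delta i ^+ 2 / 2 <= block_err (delta i) i (s i) (rm_out x0 t l (U w) (G w))].

Context {dO : measure_display} (Omega : measurableType dO)
  (P : probability Omega R) (U : Omega -> rm_space A)
  (xi : 'I_n -> nat -> Omega -> bool) (G : Omega -> array R n d)
  (s : {ffun 'I_n -> 'I_m}).
Context (run : is_run x0 (fun i => bernoulli_prob (p i) : probability bool R)
  (fun i => erasure_oracle (block_weight m a i) (code delta s) (p i)) P U xi G).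

Lemma measurable_run_out l : measurable_fun [set: Omega]
  (fun w => rm_out x0 t l (U w) (G w)).
Proof.
have mg : measurable_fun [set: Omega] (fun w => (U w, G w)).
  apply: measurable_fun_pair; first exact: run_U_measurable run.
  exact: run_G_measurable run.
exact: (measurableT_comp (rm_out_measurable x0 t l) mg).
Qed.

Lemma run_outE b w :
  (forall i (j : 'I_M), xi i j w = b (i, j)) ->
  forall l, rm_out x0 t l (U w) (G w) = exec_out x0 t a delta p s b l (U w).
Proof.
move=> xib l; apply/esym/(rm_out_exec_array _ tmin_gt0 taumin tM) => i j Sij.
have tau0 k : 0 <= tau k by rewrite (le_trans (ltW tmin_gt0)).
have cij : completed tau t i j.
  rewrite /completed -lee_fin; apply: le_trans Sij.
  by rewrite -natr1 mulrDl mul1r EFinD leeD2r // rm_start_ge.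
have jM : (j < M)%N.
  (* For [j >= M], completion would need time [(j + 1) * tau i > M * tmin >= t]. *)
  rewrite ltnNge; apply/negP => Mj.
  suff : t < t by rewrite ltxx.
  apply: le_lt_trans tM _; apply: lt_le_trans cij.
  apply: lt_le_trans (ler_wpM2l _ (taumin i)) => //.
  by rewrite ltr_pM2r // ltr_nat ltnS.
rewrite (run_step run).
  rewrite /answer cij /bit; case: insubP => [j' _ jj'|]; last by rewrite jM.
  by rewrite -jj' xib.
have := le_lt_trans Sij (ltry t); apply: le_lt_trans.
by rewrite leeDl // lee_fin.
Qed.

Lemma measurable_missed i : measurable (missed U G s i).
Proof.
rewrite (_ : missed U G s i = ~` \bigcup_(l in `I_(rm_nout A t))
  [set w | block_err (delta i) i (s i) (rm_out x0 t l (U w) (G w)) < delta i ^+ 2 / 2]).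
  apply: measurableC; apply: fin_bigcup_measurable; first exact: finite_II.
  move=> l _.
  have mf := measurable_block_err delta i (s i) (measurable_run_out l).
  have := measurable_fun_ltr mf (measurable_cst (delta i ^+ 2 / 2)).
  move=> /(_ measurableT [set true] I); rewrite setTI.
  by congr measurable; apply/seteqP; split=> u.
apply/seteqP; split=> u /=.
  by move=> ms [l /= lN]; rewrite ltNge ms.
move=> nn l lN; rewrite leNgt; apply/negP => ll.
by apply: nn; exists l.
Qed.

Lemma run_missed_ge i :
  ((\sum_(b : {ffun 'I_n * 'I_M -> bool} | erased tau t i b)
      weight b * rm_prob (miss (A := A) x0 t a delta p s b i))%:E <= P (missed U G s i))%E.
Proof.
(* The first [M] samples of every worker show the pattern [b] and the replay with [b] misses. These
   events are disjoint, independence factors their probabilities, and the run coincides with the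
   replay on each. *)
pose E b : set Omega := [set w | miss (A := A) x0 t a delta p s b i (U w) /\
  forall i' j, (j < M)%N -> [set bit b i' j] (xi i' j w)].
have PE b : P (E b) = (weight b * rm_prob (miss (A := A) x0 t a delta p s b i))%:E.
  apply: etrans (run_law run M (C := fun i' j => [set bit b i' j])
    (measurable_miss A x0 t a delta p s b i) _) _ => //.
  rewrite rm_probE; last exact: measurable_miss.
  rewrite mulrC EFinM; congr (_ * _)%E.
  have -> : weight b = \prod_(k < n) \prod_(j < M) (if b (k, j) then p k else 1 - p k).
    by rewrite pair_big; apply: eq_bigr => -[].
  rewrite -prodEFin; apply: eq_bigr => k _; rewrite -prodEFin; apply: eq_bigr => j _.
  have /andP[p0 p1] := p01 k.
  rewrite /bit insubT //= => jM; rewrite (_ : Sub _ _ = j); last exact/val_inj.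
  rewrite bernoulli_probE; last by rewrite !ltW.
  rewrite !diracE; case: (b (k, j)).
    by rewrite mem_set // memNset // mule1 mule0 adde0.
  by rewrite memNset // mem_set // mule1 mule0 add0e.
have mE b : measurable (E b).
  rewrite (_ : E b = U @^-1` miss (A := A) x0 t a delta p s b i `&`
      \bigcap_(q in [set` [pred q : 'I_n * 'I_M | true]])
        xi q.1 q.2 @^-1` [set bit b q.1 q.2]).
    apply: measurableI.
      have := run_U_measurable run measurableT (measurable_miss A x0 t a delta p s b i).
      by rewrite setTI.
    apply: fin_bigcap_measurable; first exact: finite_finset.
    move=> q _; have mb : measurable [set bit b q.1 q.2] by [].
    by have := run_xi_measurable run q.1 q.2 measurableT mb; rewrite setTI.
  apply/seteqP; split=> w [h1 h2]; split=> //.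
    by move=> [k j] _; exact: h2.
  by move=> k j jM; exact: (h2 (k, Ordinal jM)).
rewrite -sumEFin; under eq_bigr do rewrite -PE.
rewrite bigfs; [|exact: index_enum_uniq|by move=> b _; rewrite mem_index_enum].
rewrite -measure_fin_bigcup //; last first.
  apply/trivIsetP => b b' _ _ bb'; apply/seteqP; split=> // w [[_ h] [_ h']].
  case/eqP: bb'; apply/ffunP => -[k j].
  have := h k j (ltn_ord j); have := h' k j (ltn_ord j).
  rewrite /= => ->; rewrite /bit insubT //= => jM.
  by rewrite (_ : Sub _ _ = j) //; exact/val_inj.
apply: le_measure; rewrite ?inE.
- by apply: fin_bigcup_measurable; [exact: finite_finset|move=> b _; exact: mE].
- exact: measurable_missed.
move=> w [b _ [mw xw]] l lN /=; rewrite (@run_outE b); first exact: mw.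
move=> k j; have := xw k j (ltn_ord j) => /= ->.
by rewrite /bit insubT // => jM; congr (b (_, _)); exact/val_inj.
Qed.

Lemma run_error_ge l : (l < rm_nout A t)%N ->
  ((score s)%:E <=
   'E_P[fun w => (enorm (rm_out x0 t l (U w) (G w) - code delta s) ^+ 2)%R])%E.
Proof.
move=> lN.
(* Block errors add up to the squared error, and block [i] contributes at least [delta i ^+ 2 / 2]
   when it is missed. *)
pose low w : R := \sum_(i < n) delta i ^+ 2 / 2 * \1_(missed U G s i) w.
have half_ge0 i : 0 <= delta i ^+ 2 / 2 by rewrite divr_ge0 // sqr_ge0.
have mlow : measurable_fun [set: Omega] low.
  apply: measurable_sum => i; apply: measurable_funM => //.
  exact: measurable_indic (measurable_missed i).
apply: (@le_trans _ _ 'E_P[low]%E).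
  rewrite unlock /low; under eq_integral do rewrite -sumEFin.
  rewrite ge0_integral_sum //; last 2 first.
  - move=> i; apply/measurable_EFinP; apply: measurable_funM => //.
    exact: measurable_indic (measurable_missed i).
  - by move=> i w _; rewrite lee_fin mulr_ge0.
  rewrite -sumEFin; apply: lee_sum => i _.
  under eq_integral do rewrite EFinM.
  rewrite ge0_integralZl_EFin //; last first.
    by apply/measurable_EFinP; exact: measurable_indic (measurable_missed i).
  rewrite integral_indic ?setIT //; last exact: measurable_missed.
  by rewrite EFinM lee_wpmul2l ?lee_fin //; exact: run_missed_ge.
apply: expectation_le => //.
- under eq_fun do rewrite enorm_sub_code.
  by apply: measurable_sum => i; exact: measurable_block_err (measurable_run_out l).
- by move=> w; apply: sumr_ge0 => i _; rewrite mulr_ge0.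
- by move=> w; rewrite sqr_ge0.
apply: aeW => w; rewrite enorm_sub_code; apply: ler_sum => i _.
rewrite indicE; have [|_] := boolP (w \in _); last first.
  by rewrite mulr0 block_err_ge0.
by rewrite inE mulr1 => /(_ _ lN).
Qed.

End runs.

(** * Choice of parameters *)

Lemma sum_completed_le {R : realType} {n M : nat} (tau : 'I_n -> R) (t : R) (i : 'I_n) :
  (\sum_(j < M | completed tau t i j) 1) * tau i <= Num.max 0 t.
Proof.
rewrite big_mkcond /=; elim: M => [|M IH]; first by rewrite big_ord0 mul0r le_max lexx.
rewrite big_ord_recr /=; case: ifPn => [cM|_]; last by rewrite addr0.
have [tau0|tau0] := leP 0 (tau i); last first.
  rewrite le_max; apply/orP; left; apply: mulr_ge0_le0; last exact: ltW.
  by rewrite addr_ge0 // sumr_ge0 // => j _; case: ifP.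
(* If the last index is completed, [cM] bounds the time of all [M.+1] computations at once; the
   maximum with [0] covers a negative budget. *)
rewrite le_max; apply/orP; right; apply: le_trans cM.
rewrite ler_wpM2r // -natr1 lerD2r.
rewrite -[leRHS](_ : \sum_(j < M) 1 = _); last by rewrite sumr_const card_ord.
by apply: ler_sum => j _; case: ifP.
Qed.

Theorem theorem3p2 (R : realType) :
  exists c0 : R, 0 < c0 /\
  forall (n : nat), (2 <= n)%N ->
  forall (tau : 'I_n -> R), (forall i, 0 < tau i) ->
    (forall i j : 'I_n, (i <= j)%N -> tau i <= tau j) ->
  forall (A : randomized_method tau),
  forall (eps Lmax rad mu sigma2 : R),
    0 < eps -> 0 < Lmax -> 0 < rad -> 0 < mu -> 0 < sigma2 ->
    mu < Lmax / (2 * n%:R) -> eps < 1 / 100 -> 10 < rad ->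
  forall (t : R),
    t <= c0 * (n%:R^-1 * \sum_(i < n) tau i) * (sigma2 / (eps * n%:R * mu ^+ 2)) ->
  exists (d : nat) (fs : 'I_n -> 'rV[R]_d -> R)
    (dXi : measure_display) (Xi : measurableType dXi)
    (D : 'I_n -> probability Xi R) (g : 'I_n -> 'rV[R]_d -> Xi -> 'rV[R]_d)
    (x0 : 'rV[R]_d),
    let f := average fs in
    enorm (x0 - nearest_min f x0) <= rad /\
    ((forall i, L_smooth Lmax (fs i) /\ convex_on_space (fs i)) /\
     (exists x, minimizer f x)) /\
    (forall x, minimizer f x -> forall i, minimizer (fs i) x) /\
    (L_smooth Lmax f /\ polyak_lojasiewicz mu f) /\
    (forall i, [/\ measurable_oracle (g i), unbiased (D i) (g i) (fs i) &
                   variance_bounded (D i) sigma2 (g i) (fs i)]) /\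
    (forall (dO : measure_display) (Omega : measurableType dO)
        (P : probability Omega R) (U : Omega -> rm_space A)
        (xi : 'I_n -> nat -> Omega -> Xi) (G : Omega -> array R n d),
      is_run x0 D g P U xi G ->
      forall k, (k < rm_nout A t)%N ->
        let xbar := fun w => rm_out x0 t k (U w) (G w) in
        (eps%:E < 'E_P[fun w => (enorm (xbar w - nearest_min f (xbar w)) ^+ 2)%R])%E).
Proof.
(* With squared radii summing to [8 * eps], the budget makes the expected number of successes of a
   worker at most [8 / 32 = 1 / 4]. *)
exists 32^-1; split=> // n n2 tau tau0 tauM A eps Lmax rad mu sigma2
  eps0 Lmax0 rad0 mu0 sigma0 muL eps1 rad10 t tle.
have n_gt0 : (0 < n)%N by exact: ltnW.
have nR0 : 0 < n%:R :> R by rewrite ltr0n.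
have nR1 : 1 <= n%:R :> R by rewrite ler1n.
pose i0 := Ordinal n_gt0.
have taumin i : tau i0 <= tau i by exact: tauM.
pose T := \sum_(i < n) tau i.
have T0 : 0 < T.
  rewrite /T (bigD1 i0) //= ltr_pwDl // sumr_ge0 // => i _; exact: ltW.
(* Proportionality to [tau i] cancels the number [t / tau i] of attempts, so the erasure bound is
   the same for all workers. *)
pose delta i := Num.sqrt (8 * eps * tau i / T).
have delta2 i : delta i ^+ 2 = 8 * eps * tau i / T.
  by rewrite sqr_sqrtr // divr_ge0 ?mulr_ge0 // ltW.
have sum_delta2 : \sum_(i < n) delta i ^+ 2 = 8 * eps.
  rewrite (eq_bigr _ (fun i _ => delta2 i)) -mulr_suml -mulr_sumr -/T.
  by rewrite mulfK // gt_eqF.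
pose a := n%:R * mu.
have a0 : 0 < a by rewrite mulr_gt0.
pose e i := a ^+ 2 * delta i ^+ 2.
have e0 i : 0 < e i.
  by rewrite /e delta2 mulr_gt0 ?exprn_gt0 // divr_gt0 ?mulr_gt0.
(* This solves [e i * (1 / p i - 1) = sigma2]: the variance bound is attained. *)
pose p i := e i / (sigma2 + e i).
have p01 i : 0 < p i < 1.
  have ei := e0 i.
  by rewrite /p divr_gt0 ?addr_gt0 //= ltr_pdivrMr ?addr_gt0 // mul1r ltrDr.
have p_le i : p i <= e i / sigma2.
  have ei := e0 i; rewrite /p ler_wpM2l ?(ltW ei) // lef_pV2 ?posrE ?addr_gt0 //.
  by rewrite lerDl ltW.
have [M tM] : exists M : nat, t <= M%:R * tau i0.
  exists (Num.bound `|t / tau i0|); rewrite -ler_pdivrMr //.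
  by apply: le_trans (ler_norm _) _; exact: ltW (archi_boundP (normr_ge0 _)).
have psmall i : \sum_(j < M | completed tau t i j) p i <= 4^-1.
  (* [B] is the common ratio [e i / (sigma2 * tau i)]. *)
  pose B := a ^+ 2 * (8 * eps) / (T * sigma2).
  have B0 : 0 < B by rewrite divr_gt0 ?mulr_gt0 ?exprn_gt0.
  have tB : Num.max 0 t * B <= 4^-1.
    rewrite -ler_pdivlMr // ge_max divr_ge0 ?invr_ge0 ?(ltW B0) //=.
    apply: le_trans tle _; rewrite -/T le_eqVlt; apply/orP; left; apply/eqP.
    by rewrite /B /a; field; rewrite ?gt_eqF.
  apply: le_trans tB.
  apply: (@le_trans _ _ ((\sum_(j < M | completed tau t i j) 1) * tau i * B)).
    rewrite -mulrA mulr_suml; apply: ler_sum => j _; rewrite mul1r.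
    apply: le_trans (p_le i) _; rewrite le_eqVlt; apply/orP; left; apply/eqP.
    by rewrite /B /e delta2; field; rewrite ?gt_eqF.
  by rewrite ler_wpM2r ?(ltW B0) // sum_completed_le.
pose m := (2 * rm_nout A t).+1.
pose x0 : 'rV[R]_#|{: 'I_n * 'I_m}| := 0.
have [s sge] := @exists_good_score R n m tau A x0 t M a delta p p01 psmall (ltnSn _).
pose z := code delta s.
pose w := block_weight m a : 'I_n -> 'rV[R]_#|{: 'I_n * 'I_m}|.
have aL : a <= Lmax.
  move: muL; rewrite ltr_pdivlMr ?mulr_gt0 // => muL.
  by rewrite /a; nra.
have muLmax : mu <= Lmax by apply: le_trans aL; rewrite ler_peMl // ltW.
have w0 i k : 0 <= w i 0 k <= Lmax.
  rewrite mxE; case: eqP => _; first by rewrite mulr1 ltW.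
  by rewrite mulr0 lexx ltW.
have favg : average (fun i => quad (w i) z) = quad (const_mx mu) z.
  rewrite average_quad sum_block_weight; congr quad.
  by apply/rowP => k; rewrite !mxE mulKf // gt_eqF.
exists #|{: 'I_n * 'I_m}|, (fun i => quad (w i) z), _, bool,
  (fun i => bernoulli_prob (p i)), (fun i => erasure_oracle (w i) z (p i)), x0.
rewrite /= favg; split; [|split; [split|split; [|split; [split|split]]]].
- rewrite nearest_min_quad_const // -(@ler_pXn2r _ 2) ?nnegrE ?enorm_ge0 ?(ltW rad0) //.
  rewrite [leLHS](_ : _ = enorm z ^+ 2); last first.
    by rewrite !enorm_sqr; apply: eq_bigr => k _; rewrite !mxE sub0r sqrrN.
  (* The squared distance is [8 * eps < 8 / 100], while [rad > 10]. *)
  by rewrite enorm_code sum_delta2; nra.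
- move=> i; split; first exact: quad_lsmooth.
  by apply: quad_convex => k; have /andP[] := w0 i k.
- by exists z; apply: quad_center_minimizer => k; rewrite mxE ltW.
- move=> x /quad_const_minimizer -> // i.
  by apply: quad_center_minimizer => k; have /andP[] := w0 i k.
- apply: quad_lsmooth => // k; rewrite mxE.
  by rewrite (ltW mu0).
- exact: quad_const_pl.
- move=> i; split.
  + exact: erasure_oracle_measurable.
  + exact: erasure_oracle_unbiased.
  + move=> x; rewrite erasure_oracle_variance // lee_fin sum_sqr_weight_code.
    rewrite -/(e i) /p le_eqVlt; apply/orP; left; apply/eqP.
    have ei := e0 i; field.
    by rewrite !gt_eqF ?addr_gt0.
move=> dO Omega P U xi G run k kN.
have tau0min : 0 < tau i0 by [].
have := run_error_ge p01 tau0min taumin tM run kN.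
have -> : nearest_min (quad (const_mx mu) z) = fun=> z.
  by apply/funext => x; exact: nearest_min_quad_const.
apply: lt_le_trans; rewrite lte_fin; apply: lt_le_trans sge.
(* The score is at least [3 / 16 * (8 * eps) = 3 / 2 * eps], strictly above [eps]. *)
by rewrite sum_delta2; lra.
Qed.
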